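(* Fix a simple Lie algebra $\mathfrak{g}$ and a (finite dimensional) representation $V$ of $\mathfrak{g}$. Let $L$ be a 2-component link in $S^3$ with one unknotted component $C_2$, and for each integer $n$ let $K_n$ denote the knot in $S^3$ obtained from the other component by $-1/n$ filling on $C_2$. Let $Z^{\mathfrak{g}}_{V,K_n}(q)$ be the quantum group invariant of the (zero-framed) knot $K_n$, and let $Q(n)$ be the framing exponent associated to a presentation of $L$ as the closure of an $(r,r)$ tangle in the solid torus $S^3\setminus C_2$. Then the sequence $q^{Q(n)}Z^{\mathfrak{g}}_{V,K_n}(q)\in\mathbb{Q}(q)$ is recurrent.
   Context: Recurrent sequence: a sequence $R_n$ in $\mathbb{Q}(q)$ (indexed by the integers $n$) is called recurrent if there exist a natural number $d$ and $c_0,\dots,c_d\in\mathbb{Q}(q)$, independent of $n$, with $c_d\neq 0$, such that $\sum_{k=0}^d c_kR_{n+k}=0$ for all $n$. Quantum group invariant: $Z^{\mathfrak{g}}_{V,K}(q)\in\mathbb{Z}[q^{\pm1}]$ is the (Reshetikhin-Turaev) quantum group invariant of a zero-framed knot $K$ colored by $V$; it can be computed as a trace of an operator associated to a braid (or tangle) presentation of $K$. For example, for $\mathfrak{g}=\mathfrak{sl}_2$ and $V=\mathbb{C}^2$ the defining representation it is the Jones polynomial of $K$. The exponent $Q(n)$: since $C_2$ is unknotted, $S^3\setminus C_2$ is a solid torus $S^1\times D^2$, and the other component of $L$ is a knot in $S^1\times D^2$, hence it is the closure of an $(r,r)$ tangle $\alpha$ for some $r$. Let $\beta$ be a braid representative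 of a full positive twist in the braid group on $r$ strands; then $K_n$ is the closure of the tangle $\alpha\beta^n$. $Q(n)$ denotes half of the negative of the writhe of $\alpha\beta^n$, multiplied by the quadratic Casimir value of $\mathfrak{g}$ in $V$. It is the framing correction, with conventions such that $Z^{\mathfrak{g}}_{V,K_n}(q)=q^{-Q(n)}\operatorname{tr}(AB^n)$, where $A$ and $B$ are the endomorphisms associated by the quantum group functor with color $V$ to the tangles $\alpha$ and $\beta$. *)

(* Defs.v *)
From HB Require Import structures.
From Stdlib Require Import Relation_Operators.
From mathcomp Require Import all_boot all_order all_algebra.
From mathcomp.real_closed Require Import mxtens.

Set Implicit Arguments.
Unset Strict Implicit.
Unset Printing Implicit Defensive.

Import Order.TTheory GRing.Theory Num.Theory.
Local Open Scope ring_scope.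

(** * Simple Lie algebras and their representations *)

Section LieAlgebra.
Variables (C : numClosedFieldType) (g : vectType C) (br : g -> g -> g).

Record lie_bracket : Prop := LieBracket {
  br_linl : forall (a : C) x y z, br (a *: x + y) z = a *: br x z + br y z;
  br_linr : forall (a : C) x y z, br z (a *: x + y) = a *: br z x + br z y;
  br_alt : forall x, br x x = 0;
  br_jacobi : forall x y z, br x (br y z) + br y (br z x) + br z (br x y) = 0 }.

Record simple_lie : Prop := SimpleLie {
  simple_bracket : lie_bracket;
  simple_nonabelian : exists x y, br x y != 0;
  simple_ideals : forall I : {vspace g},
    (forall x y, y \in I -> br x y \in I) -> I = 0%VS \/ I = fullv }.

Record lie_rep (V : vectType C) (rho : g -> 'End(V)) : Prop := LieRep {
  rep_linear : forall (a : C) x y, rho (a *: x + y) = a *: rho x + rho y;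
  rep_bracket : forall x y,
    rho (br x y) = (rho x \o rho y)%VF - (rho y \o rho x)%VF }.

End LieAlgebra.

(** [cartan i j] is <alpha_j, alpha_i^vee> and [symm i] is (alpha_i, alpha_i)/2.
    Coprimality of the [symm i] normalises the form: in an irreducible root
    system short roots have square length 2. *)
Record cartan_datum := CartanDatum {
  rank : nat;
  cartan : 'M[int]_rank;
  symm : 'I_rank -> nat;
  cartan_diag : forall i, cartan i i = 2;
  cartan_offdiag : forall i j, i != j -> cartan i j <= 0;
  symm_gt0 : forall i, (0 < symm i)%N;
  symm_cartan : forall i j,
    (symm i)%:Z * cartan i j = (symm j)%:Z * cartan j i;
  symm_coprime : \big[gcdn/0%N]_i symm i = 1%N;
  cartan_finite : forall x : 'I_rank -> rat, (exists i, x i != 0) ->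
    0 < \sum_i \sum_j (symm i)%:R * (cartan i j)%:~R * x i * x j }.

Arguments symm : clear implicits.

Section Chevalley.
Variables (C : numClosedFieldType) (g : vectType C) (br : g -> g -> g).
Variables (D : cartan_datum) (e f h : 'I_(rank D) -> g).

(** Together with [simple_lie br], this says that g is the simple Lie algebra
    with Cartan matrix [cartan D]. *)
Record chevalley_generators : Prop := ChevalleyGenerators {
  chev_hh : forall i j, br (h i) (h j) = 0;
  chev_he : forall i j, br (h i) (e j) = (cartan D i j)%:~R *: e j;
  chev_hf : forall i j, br (h i) (f j) = - ((cartan D i j)%:~R *: f j);
  chev_ef : forall i j, br (e i) (f j) = if i == j then h i else 0;
  chev_free : free [seq h i | i <- enum 'I_(rank D)];
  chev_gen : forall U : {vspace g},
    (forall i, [&& e i \in U, f i \in U & h i \in U]) ->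
    (forall x y, x \in U -> y \in U -> br x y \in U) -> U = fullv }.

(** The value on the coroots is the one forced by (alpha_i, alpha_i)/2 = symm i
    under the identification of the Cartan subalgebra with its dual. *)
Record normalized_form (kap : g -> g -> C) : Prop := NormalizedForm {
  form_lin : forall (a : C) x y z,
    kap (a *: x + y) z = a * kap x z + kap y z;
  form_sym : forall x y, kap x y = kap y x;
  form_inv : forall x y z, kap (br x y) z = kap x (br y z);
  form_coroot : forall i j,
    kap (h i) (h j) = (cartan D i j)%:~R / (symm D j)%:R }.

Definition casimir_value (V : vectType C) (rho : g -> 'End(V)) (c : rat) :=
  exists (kap : g -> g -> C) (X Y : 'I_(\dim {:g}) -> g),
    [/\ normalized_form kap,
        forall a b, kap (X a) (Y b) = (a == b)%:R &
        \sum_a (rho (X a) \o rho (Y a))%VF = ratr c *: \1%VF].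

Definition weight_mult (V : vectType C) (rho : g -> 'End(V))
    (mu : 'rV[int]_(rank D)) : nat :=
  \dim (\bigcap_i passmx.leigenspace (rho (h i)) (mu 0 i)%:~R)%VS.

End Chevalley.

(** * The field Q(q^(1/N)) *)

Notation Qv := {fraction {poly rat}}.

Section Scalars.
Variable D : cartan_datum.

(** With N = 2 det A, the generator v of Qv = Q(v) stands for q^(1/N); every
    (lambda, mu)/2 with lambda, mu in the weight lattice lies in (1/N) Z. *)
Definition root_order : nat := (2 * `|\det (cartan D)|)%N.

Definition qpow (x : rat) : Qv :=
  (FracField.tofrac 'X) ^ (Num.floor (x * root_order%:R)).

Definition in_Qq (x : Qv) : Prop :=
  exists a b : {poly rat}, b != 0 /\
    x = FracField.tofrac (a \Po 'X^root_order)
        / FracField.tofrac (b \Po 'X^root_order).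

Definition recurrent (R : int -> Qv) : Prop :=
  exists (d : nat) (c : 'I_d.+1 -> Qv),
    [/\ forall k, in_Qq (c k),
        c ord_max != 0 &
        forall n : int, \sum_k c k * R (n + (k : nat)%:Z) = 0].

(** A weight is the row of its values on the simple coroots. *)
Definition weight_form (la mu : 'rV[int]_(rank D)) : rat :=
  let m := invmx (map_mx intr (cartan D)) *m map_mx intr la^T in
  \sum_k m k 0 * (symm D k)%:R * (mu 0 k)%:~R.

Definition weyl_vector : 'rV[int]_(rank D) := const_mx 1.

(** The quantum parameter of U_q(g) is q^(1/2), so that K_i acts on the weight
    space mu by q^((alpha_i, mu)/2). *)
Definition q_ (i : 'I_(rank D)) : Qv := qpow ((symm D i)%:R / 2).

Definition qint i (n : nat) : Qv :=
  (q_ i ^+ n - q_ i ^- n) / (q_ i - (q_ i)^-1).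

Definition qfact i (n : nat) : Qv := \prod_(1 <= k < n.+1) qint i k.

Definition qbinom i (n k : nat) : Qv :=
  qfact i n / (qfact i k * qfact i (n - k)).

(** * Type 1 modules over U_q(g), in a basis of weight vectors *)

Record uq_data (m : nat) := UqData {
  wt : 'I_m -> 'rV[int]_(rank D);
  uE : 'I_(rank D) -> 'M[Qv]_m;
  uF : 'I_(rank D) -> 'M[Qv]_m }.

Definition uK m (M : uq_data m) (i : 'I_(rank D)) : 'M[Qv]_m :=
  diag_mx (\row_b q_ i ^ (wt M b 0 i)).

Definition uKV m (M : uq_data m) (i : 'I_(rank D)) : 'M[Qv]_m :=
  diag_mx (\row_b q_ i ^ (- wt M b 0 i)).

Definition qserre m (X : 'I_(rank D) -> 'M[Qv]_m) (i j : 'I_(rank D)) :=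
  let r := `|1 - cartan D i j|%N in
  \sum_(s < r.+1)
    ((-1) ^+ s * qbinom i r s) *: (X i ^+ (r - s) *m X j *m X i ^+ s).

Record uq_module m (M : uq_data m) : Prop := UqModule {
  uq_KE : forall i j,
    uK M i *m uE M j = q_ i ^ (cartan D i j) *: (uE M j *m uK M i);
  uq_KF : forall i j,
    uK M i *m uF M j = q_ i ^ (- cartan D i j) *: (uF M j *m uK M i);
  uq_EF : forall i j, uE M i *m uF M j - uF M j *m uE M i =
    if i == j then (q_ i - (q_ i)^-1)^-1 *: (uK M i - uKV M i) else 0;
  uq_serreE : forall i j, i != j -> qserre (uE M) i j = 0;
  uq_serreF : forall i j, i != j -> qserre (uF M) i j = 0 }.

(** (# stands for the tensor product in comments.)
    The coproduct is E |-> E # 1 + K # E, F |-> F # K^-1 + 1 # F, so the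
    antipode is E |-> - K^-1 E, F |-> - F K. *)
Definition uq_dual m (M : uq_data m) : uq_data m := UqData
  (fun b => - wt M b)
  (fun i => - (uKV M i *m uE M i)^T)
  (fun i => - (uF M i *m uK M i)^T).

Section Braiding.
Variables (m n : nat) (M : uq_data m) (N : uq_data n).

Definition coprodE i := uE M i *t 1%:M + uK M i *t uE N i.
Definition coprodF i := uF M i *t uKV N i + 1%:M *t uF N i.
Definition coprod_opE i := 1%:M *t uE N i + uE M i *t uK N i.
Definition coprod_opF i := uKV M i *t uF N i + uF M i *t 1%:M.

Definition uq_word k (X : 'I_(rank D) -> 'M[Qv]_k) (s : seq 'I_(rank D)) :=
  foldr (fun i Z => X i *m Z) 1%:M s.

(** Action on M # N of sum_(a, b) Theta a b F_a # E_b.  Words of length >= n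
    in the E_i vanish on the n-dimensional module N, so the sum is complete. *)
Definition theta_mx (Theta : seq 'I_(rank D) -> seq 'I_(rank D) -> Qv) :
    'M[Qv]_(m * n) :=
  \sum_(k < n) \sum_(a : k.-tuple 'I_(rank D)) \sum_(b : k.-tuple 'I_(rank D))
    Theta a b *: (uq_word (uF M) a *t uq_word (uE N) b).

Definition cartan_part : 'M[Qv]_(m * n) :=
  diag_mx (\row_x let: (i, j) := mxtens_unindex x in
                  qpow (- weight_form (wt M i) (wt N j) / 2)).

(** The operator such that the braiding N # M -> M # N is
    [Rop Theta] after the flip N # M -> M # N. *)
Definition Rop Theta : 'M[Qv]_(m * n) := theta_mx Theta *m cartan_part.

End Braiding.

(** Lusztig's quasi-R-matrix, in the completion of U^- # U^+ and written in
    words in the F_i and the E_i; it is characterised by its leading term and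
    the intertwining property on all finite dimensional type 1 modules. *)
Record quasi_Rmatrix (Theta : seq 'I_(rank D) -> seq 'I_(rank D) -> Qv) : Prop
    := QuasiRmatrix {
  theta_nil : Theta [::] [::] = 1;
  theta_homog : forall a b, Theta a b != 0 -> perm_eq a b;
  theta_intertwine : forall m n (M : uq_data m) (N : uq_data n),
    uq_module M -> uq_module N -> forall i,
      Rop M N Theta *m coprod_opE M N i = coprodE M N i *m Rop M N Theta /\
      Rop M N Theta *m coprod_opF M N i = coprodF M N i *m Rop M N Theta }.

End Scalars.

(** A representation of U_q(g) deforms the representation of g with the same
    weight multiplicities. *)
Definition quantizes (C : numClosedFieldType) (g : vectType C)
    (D : cartan_datum) (h : 'I_(rank D) -> g)
    (V : vectType C) (rho : g -> 'End(V)) m (M : uq_data D m) : Prop :=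
  forall mu : 'rV[int]_(rank D),
    #|[pred b | wt M b == mu]| = weight_mult h rho mu.

(** * Oriented tangle diagrams *)

(** A diagram is a word of elementary layers read from bottom to top; a level
    is the list of orientations ([true] = upwards) of the strands cutting it.
    In [Cross p] the strand from position p below to p + 1 above passes over
    (so it is positive when its strands are parallel); in [CrossV p] it passes
    under.  [Cup p a] creates strands oriented a, ~~ a at p, p + 1. *)
Inductive layer :=
| Cross of nat
| CrossV of nat
| Cup of nat & bool
| Cap of nat.

Definition above (s : seq bool) (L : layer) : seq bool :=
  match L with
  | Cross p | CrossV p =>
      take p s ++ [:: nth true s p.+1; nth true s p] ++ drop p.+2 s
  | Cup p a => take p s ++ [:: a; ~~ a] ++ drop p s
  | Cap p => take p s ++ drop p.+2 s
  end.

Definition admissible (s : seq bool) (L : layer) : bool :=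
  match L with
  | Cross p | CrossV p => (p.+1 < size s)%N
  | Cup p _ => (p <= size s)%N
  | Cap p => (p.+1 < size s)%N && (nth true s p != nth true s p.+1)
  end.

Fixpoint tangle (s : seq bool) (w : seq layer) (t : seq bool) : bool :=
  if w is L :: w' then admissible s L && tangle (above s L) w' t else s == t.

Definition layer_sign (s : seq bool) (L : layer) : int :=
  match L with
  | Cross p => if nth true s p == nth true s p.+1 then 1 else -1
  | CrossV p => if nth true s p == nth true s p.+1 then -1 else 1
  | _ => 0
  end.

Fixpoint writhe (s : seq bool) (w : seq layer) : int :=
  if w is L :: w' then layer_sign s L + writhe (above s L) w' else 0.

Definition flip_layer (L : layer) : layer :=
  match L with
  | Cross p => CrossV p
  | CrossV p => Cross p
  | _ => L
  end.

(** (sigma_1 ... sigma_(r-1))^r *)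
Definition full_twist (r : nat) : seq layer :=
  flatten (nseq r [seq Cross p | p <- iota 0 r.-1]).

Definition full_twist_pow (r : nat) (n : int) : seq layer :=
  match n with
  | Posz k => flatten (nseq k (full_twist r))
  | Negz k => flatten (nseq k.+1 (rev (map flip_layer (full_twist r))))
  end.

(** Closure of an (s, s) tangle by arcs on its right, as a closed diagram. *)
Definition tangle_closure (s : seq bool) (w : seq layer) : seq layer :=
  [seq Cup i (nth true s i) | i <- iota 0 (size s)] ++ w
  ++ [seq Cap i | i <- rev (iota 0 (size s))].

Section Components.
Variable w : seq layer.

Definition level (k : nat) : seq bool := foldl above [::] (take k w).

(** Where a strand at position i below a layer comes out above it. *)
Definition through (L : layer) (i : nat) : option nat :=
  match L with
  | Cross p | CrossV p =>
      Some (if i == p then p.+1 else if i == p.+1 then p else i)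
  | Cup p _ => Some (if (i < p)%N then i else i.+2)
  | Cap p => if (i < p)%N then Some i
             else if (i < p.+2)%N then None else Some (i - 2)%N
  end.

(** The points (k, i) of a closed diagram: the i-th strand at level k. *)
Definition point (x : nat * nat) : bool :=
  (x.1 <= size w)%N && (x.2 < size (level x.1))%N.

Inductive diagram_arc : nat * nat -> nat * nat -> Prop :=
| arc_through k L i j :
    onth w k = Some L -> point (k, i) -> through L i = Some j ->
    diagram_arc (k, i) (k.+1, j)
| arc_cup k p a : onth w k = Some (Cup p a) -> diagram_arc (k.+1, p) (k.+1, p.+1)
| arc_cap k p : onth w k = Some (Cap p) -> diagram_arc (k, p) (k, p.+1).

Definition knot_diagram : Prop :=
  tangle [::] w [::] /\
  exists2 x, point x &
    forall y, point y -> clos_refl_sym_trans (nat * nat)%type diagram_arc x y.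

End Components.

(** A 2-component link with an unknotted component C_2, presented in the solid
    torus complementary to C_2: the other component is the closure of [strand],
    and C_2 is the axis of the closure. *)
Record axis_link := AxisLink {
  ends : seq bool;
  strand : seq layer;
  strand_tangle : tangle ends strand ends;
  strand_knot : knot_diagram (tangle_closure ends strand) }.

Definition twisted_tangle (L : axis_link) (n : int) : seq layer :=
  strand L ++ full_twist_pow (size (ends L)) n.

(** The result of -1/n filling on C_2: n full positive twists are inserted in
    the strands running through a disc bounded by C_2. *)
Definition surgery_knot (L : axis_link) (n : int) : seq layer :=
  tangle_closure (ends L) (twisted_tangle L n).

(** * The quantum group invariant *)

Section Functor.
Variables (D : cartan_datum) (m : nat) (M : uq_data D m).
Variable Theta : seq 'I_(rank D) -> seq 'I_(rank D) -> Qv.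

Definition colour (a : bool) : uq_data D m := if a then M else uq_dual M.

(** Matrix coefficients of the functor: a strand oriented upwards carries V,
    one oriented downwards carries V^*, and bases are dual to each other.
    The pivotal element is K_(2 rho)^-1. *)

(** coefficient of z # t in the image of x # y under V^a # V^b -> V^b # V^a *)
Definition cross_coef (a b : bool) (x y z t : 'I_m) : Qv :=
  Rop (colour b) (colour a) Theta (mxtens_index (z, t)) (mxtens_index (y, x)).

(** the same for the inverse of the braiding V^b # V^a -> V^a # V^b *)
Definition crossV_coef (a b : bool) (x y z t : 'I_m) : Qv :=
  invmx (Rop (colour a) (colour b) Theta)
    (mxtens_index (t, z)) (mxtens_index (x, y)).

Definition cup_coef (a : bool) (x y : 'I_m) : Qv :=
  if x != y then 0 else
  if a then 1 else qpow D (weight_form (weyl_vector D) (wt M x)).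

Definition cap_coef (a : bool) (x y : 'I_m) : Qv :=
  if x != y then 0 else
  if a then qpow D (- weight_form (weyl_vector D) (wt M x)) else 1.

Definition layer_coef (s : seq bool) (L : layer) (i j : seq 'I_m) : Qv :=
  match L with
  | Cross p =>
      if (drop p i, drop p j) is (x :: y :: i', z :: t :: j') then
        ((take p i == take p j) && (i' == j'))%:R
        * cross_coef (nth true s p) (nth true s p.+1) x y z t
      else 0
  | CrossV p =>
      if (drop p i, drop p j) is (x :: y :: i', z :: t :: j') then
        ((take p i == take p j) && (i' == j'))%:R
        * crossV_coef (nth true s p) (nth true s p.+1) x y z t
      else 0
  | Cup p a =>
      if drop p j is z :: t :: j' then
        ((take p i == take p j) && (drop p i == j'))%:R * cup_coef a z t
      else 0
  | Cap p =>
      if drop p i is x :: y :: i' then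
        ((take p i == take p j) && (i' == drop p j))%:R
        * cap_coef (nth true s p) x y
      else 0
  end.

Fixpoint tangle_coef (s : seq bool) (w : seq layer) (i j : seq 'I_m) : Qv :=
  if w is L :: w' then
    \sum_(k : (size (above s L)).-tuple 'I_m)
      layer_coef s L i k * tangle_coef (above s L) w' k j
  else (i == j)%:R.

(** Half of the negative of the writhe times the Casimir value. *)
Definition framing_exponent (c : rat) (s : seq bool) (w : seq layer) : rat :=
  - ((writhe s w)%:~R / 2) * c.

Definition quantum_invariant (c : rat) (K : seq layer) : Qv :=
  (qpow D (framing_exponent c [::] K))^-1 * tangle_coef [::] K [::] [::].

End Functor.

Definition Qexp (c : rat) (L : axis_link) (n : int) : rat :=
  framing_exponent c (ends L) (twisted_tangle L n).

(* Main.v *)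
Require Import Defs.
From mathcomp Require Import all_boot all_order all_algebra.
From mathcomp.real_closed Require Import mxtens.

Set Implicit Arguments.
Unset Strict Implicit.
Unset Printing Implicit Defensive.

Import Order.TTheory GRing.Theory Num.Theory.
Local Open Scope ring_scope.
Local Notation tofrac := FracField.tofrac.

(** A closed diagram has the writhe of the tangle it closes, so the powers of q
    cancel and the sequence is the evaluation of the closure of alpha beta^n,
    that is x B^n y, where B is the operator of the full twist, x that of the
    lower arcs followed by alpha, and y that of the upper arcs.  B is invertible
    because the quasi-R-matrix is unitriangular for the height grading, and
    negative twists give its inverse.  The entries of B lie in Q(v) with
    v = q^(1/N), a space of dimension N over Q(q), so the powers of B satisfy a
    linear relation over Q(q). *)

(** * Clearing denominators over an integral domain *)

Section Fractions.
Variable R : idomainType.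

Lemma fraction_numden (x : {fraction R}) :
  exists a b : R, b != 0 /\ x = tofrac a / tofrac b.
Proof.
elim/quotW: x => x; exists (frac x).1, (frac x).2; split;
  first exact: denom_ratioP.
have b0 : tofrac (frac x).2 != 0 :> {fraction R}
  by rewrite tofrac_eq0 denom_ratioP.
apply: (canRL (mulfK b0)).
rewrite !piE; apply/eqP; rewrite eqmodE /= FracField.equivfE /FracField.mulf.
by rewrite !numden_Ratio ?mulf_neq0 ?denom_ratioP ?oner_neq0 //= !mulr1 mulrC.
Qed.

Lemma common_denominator (I : finType) (x : I -> {fraction R}) :
  exists (d : R) (y : I -> R),
    d != 0 /\ forall i, tofrac d * x i = tofrac (y i).
Proof.
have /fin_all_exists[ab abE] (i : I) : exists ab : R * R,
    ab.2 != 0 /\ x i = tofrac ab.1 / tofrac ab.2.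
  by have [a [b xE]] := fraction_numden (x i); exists (a, b).
exists (\prod_i (ab i).2), (fun i => (ab i).1 * \prod_(j | j != i) (ab j).2);
  split.
  by apply/prodf_neq0 => i _; case: (abE i).
move=> i; have [b0 ->] := abE i.
rewrite (bigD1 i) //= !tofracM mulrCA [X in _ * X = _]mulrAC divff
  ?tofrac_eq0 //.
by rewrite mul1r mulrC.
Qed.

(** A matrix with more rows than columns has a nonzero left kernel vector over the fraction field; a
    common denominator brings its coordinates back into [R]. *)
Lemma wide_family_dependent n (x : 'I_n.+1 -> 'I_n -> R) :
  exists u : 'I_n.+1 -> R,
    (exists k, u k != 0) /\ forall j, \sum_k u k * x k j = 0.
Proof.
pose A : 'M[{fraction R}]_(n.+1, n) := \matrix_(k, j) tofrac (x k j).
have : kermx A != 0.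
  by rewrite kermx_eq0 /row_free; apply/eqP => rA; have := rank_leq_col A;
    rewrite rA ltnn.
move=> /rowV0Pn[v /sub_kermxP vA v0].
have [d [u [d0 uE]]] := common_denominator (fun k => v 0 k).
exists u; split.
  have /rV0Pn[k vk] := v0.
  by exists k; rewrite -tofrac_eq0 -uE mulf_neq0 // tofrac_eq0.
move=> j; apply/eqP; rewrite -tofrac_eq0 rmorph_sum /=.
have /matrixP/(_ 0 j) := vA; rewrite !mxE => vAj.
apply/eqP; transitivity (tofrac d * \sum_k v 0 k * A k j);
  last by rewrite vAj mulr0.
rewrite mulr_sumr; apply: eq_bigr => k _.
by rewrite mxE tofracM -uE mulrA.
Qed.

End Fractions.

(** * Linear relations over [F(X^N)] among the powers of a matrix over [F(X)] *)

Lemma poly_residue_split (R : comNzRingType) (N : nat) (p : {poly R}) :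
  (0 < N)%N ->
  exists f : 'I_N -> {poly R}, p = \sum_(j < N) 'X^j * (f j \Po 'X^N).
Proof.
(* Monomials are sorted by their exponent modulo [N]. The bound [size p] is generous, the
   coefficients beyond it being zero. *)
move=> N0; exists (fun j => \poly_(i < size p) p`_(i * N + j)).
apply/polyP => i; rewrite coef_sum.
rewrite (bigD1 (Ordinal (ltn_pmod i N0))) //= big1 ?addr0 => [|j jne].
  rewrite coefXnM ltnNge leq_mod /= coef_comp_poly_Xn //.
  have -> : (i - i %% N = i %/ N * N)%N by rewrite {1}(divn_eq i N) addnK.
  rewrite dvdn_mull // mulnK // coef_poly -divn_eq.
  case: ltnP => // le; rewrite nth_default //; apply: leq_trans le _;
    exact: leq_div.
rewrite coefXnM coef_comp_poly_Xn //; case: ltnP => // ji.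
case: ifP => // /dvdnP[k kE]; case/eqP: jne; apply/val_inj => /=.
by rewrite -(subnK ji) kE modnMDl modn_small.
Qed.

Section Annihilator.
Variables (F : fieldType) (N : nat).
Hypothesis N_gt0 : (0 < N)%N.
Local Notation K := {fraction {poly F}}.

(* The n^2 N coordinates of 1, B, B^2, ... over F(X^N) satisfy a linear
   relation once there are more powers than coordinates. *)
Lemma matrix_annihilator n (B : 'M[K]_n) :
  exists (d : nat) (u : 'I_d.+1 -> {poly F}),
    u ord_max != 0 /\ \sum_k tofrac (u k \Po 'X^N) *: B ^+ (k : nat) = 0.
Proof.
pose J := ('I_n * 'I_n * 'I_N)%type; pose D := #|{: J}|.
have [d [y [d0 yE]]] := common_denominator
  (fun t : 'I_D.+1 * ('I_n * 'I_n) => (B ^+ t.1) t.2.1 t.2.2).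
have /fin_all_exists[f fE] (t : 'I_D.+1 * ('I_n * 'I_n)) :
    exists g : 'I_N -> {poly F}, y t = \sum_(j < N) 'X^j * (g j \Po 'X^N).
  exact: poly_residue_split.
have [u [u0 uE]] := wide_family_dependent
  (fun k (j : 'I_D) => f (k, (enum_val j).1) (enum_val j).2).
(* Entry by entry, after multiplication by [d], the sum regroups as a combination of the [X^j] whose
   coefficients are the relations [uE] with [X^N] substituted. *)
have rel : \sum_k tofrac (u k \Po 'X^N) *: B ^+ (k : nat) = 0.
  apply/matrixP => a b; rewrite summxE mxE.
  apply: (@mulfI _ (tofrac d)); first by rewrite tofrac_eq0.
  rewrite mulr0 mulr_sumr.
  under eq_bigr => k _ do
    rewrite mxE mulrCA (yE (k, (a, b))) -tofracM fE mulr_sumr.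
  rewrite -rmorph_sum exchange_big /= big1 ?tofrac0 // => j _.
  under eq_bigr => k _ do rewrite mulrCA -comp_polyM.
  rewrite -mulr_sumr -(raddf_sum (comp_poly 'X^N)).
  have := uE (enum_rank ((a, b), j)); rewrite enum_rankK /= => ->.
  by rewrite comp_poly0 mulr0.
(* The relation is cut at the last index with a nonzero coefficient, which makes the leading
   coefficient nonzero. *)
have [k0 uk0] := u0.
case: (@arg_maxnP _ k0 (fun k => u k != 0) (fun k : 'I_D.+1 => k) uk0) => k uk
  kmax.
have kD : (k.+1 <= D.+1)%N by [].
exists k, (fun i => u (widen_ord kD i)); split.
  by rewrite (_ : widen_ord _ _ = k) //; apply/val_inj.
rewrite -[RHS]rel [RHS](bigID (fun i : 'I_D.+1 => (i < k.+1)%N)) /=.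
rewrite [X in _ = _ + X]big1 ?addr0 => [|i];
  first by rewrite (big_ord_narrow kD).
rewrite -leqNgt => ki; suff -> : u i = 0 by rewrite comp_poly0 tofrac0 scale0r.
by apply/eqP; apply: contraTT ki => /kmax; rewrite -leqNgt.
Qed.

End Annihilator.

(** * Orientations and writhe of tangle words; closure *)

Lemma above_cat s u L : admissible s L -> above (s ++ u) L = above s L ++ u.
Proof.
have crossing p : (p.+1 < size s)%N -> take p (s ++ u) ++
    [:: nth true (s ++ u) p.+1; nth true (s ++ u) p] ++ drop p.+2 (s ++ u) =
    (take p s ++ [:: nth true s p.+1; nth true s p] ++ drop p.+2 s) ++ u.
  move=> ps; rewrite takel_cat 1?ltnW 1?ltnW // !nth_cat ps (ltnW ps).
  by rewrite drop_cat ltn_neqAle ps andbT; case: eqP => [->|];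
    rewrite ?drop_size ?subnn ?drop0 -!catA.
case: L => [p|p|p a|p] /=; try exact: crossing.
  move=> ps; rewrite takel_cat // drop_cat ltn_neqAle ps andbT.
  by case: eqP => [->|]; rewrite ?drop_size ?subnn ?drop0 -!catA.
case/andP=> ps _; rewrite takel_cat 1?ltnW 1?ltnW //.
by rewrite drop_cat ltn_neqAle ps andbT; case: eqP => [->|];
  rewrite ?drop_size ?subnn ?drop0 -!catA.
Qed.

Lemma layer_sign_cat s u L : admissible s L ->
  layer_sign (s ++ u) L = layer_sign s L.
Proof. by case: L => //= p ps; rewrite !nth_cat ps (ltnW ps). Qed.

Lemma tangle_state s w t : tangle s w t -> foldl above s w = t.
Proof. by elim: w s => [|L w IH] s /= => [/eqP//|/andP[_ /IH]]. Qed.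

(** This serves closures, where the return strands [u] run idle on the right of the tangle. *)
Lemma tangle_catr s u w t : tangle s w t -> tangle (s ++ u) w (t ++ u).
Proof.
elim: w s => [|L w IH] s /= => [/eqP-> //|/andP[sL /IH]];
  rewrite above_cat // => ->.
rewrite andbT; case: L sL => [p|p|p a|p] /=; rewrite size_cat.
- by move=> ps; apply: leq_trans ps (leq_addr _ _).
- by move=> ps; apply: leq_trans ps (leq_addr _ _).
- by move=> ps; apply: leq_trans ps (leq_addr _ _).
- by case/andP=> ps sp; rewrite !nth_cat ps (ltnW ps) sp andbT (leq_trans ps)
    ?leq_addr.
Qed.

Lemma tangle_cat s w1 t w2 u :
  tangle s w1 t -> tangle t w2 u -> tangle s (w1 ++ w2) u.
Proof.
by elim: w1 s => [|L w IH] s /= => [/eqP-> //|/andP[-> /IH] h /h].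
Qed.

Lemma tangle_nseq s w k : tangle s w s -> tangle s (flatten (nseq k w)) s.
Proof. by move=> sw; elim: k => //= k; apply: tangle_cat. Qed.

Lemma writhe_cat s w1 w2 :
  writhe s (w1 ++ w2) = writhe s w1 + writhe (foldl above s w1) w2.
Proof. by elim: w1 s => [|L w IH] s /=; rewrite ?add0r // IH addrA. Qed.

Lemma writhe_catr s u w t : tangle s w t -> writhe (s ++ u) w = writhe s w.
Proof.
elim: w s => //= L w IH s /andP[sL /IH]; rewrite layer_sign_cat // above_cat //.
by move=> ->.
Qed.

(** Each new cup opens in the middle of the strands already present, so the arcs are nested and the
    return strands appear in reverse order with opposite orientations. *)
Lemma state_cups s :
  foldl above [::] [seq Cup i (nth true s i) | i <- iota 0 (size s)] =
  s ++ map negb (rev s).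
Proof.
elim/last_ind: s => //= s a IH.
rewrite size_rcons -addn1 iotaD map_cat foldl_cat add0n /=.
have -> : [seq Cup i (nth true (rcons s a) i) | i <- iota 0 (size s)] =
          [seq Cup i (nth true s i) | i <- iota 0 (size s)].
  by apply/eq_in_map => i; rewrite mem_iota nth_rcons /= => ->.
by rewrite IH take_size_cat // drop_size_cat // nth_rcons ltnn eqxx rev_rcons
  /= cat_rcons.
Qed.

(** Cups and caps carry no sign and the return strands take part in no crossing. *)
Lemma writhe_closure s w :
  tangle s w s -> writhe [::] (tangle_closure s w) = writhe s w.
Proof.
move=> sw; rewrite /tangle_closure !writhe_cat state_cups (writhe_catr _ sw).
have cups l t : writhe t [seq Cup i (nth true s i) | i <- l] = 0.
  by elim: l t => //= i l IH t; rewrite IH.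
have caps l t : writhe t [seq Cap i | i <- l] = 0.
  by elim: l t => //= i l IH t; rewrite IH.
by rewrite cups caps add0r addr0.
Qed.

(** * Braid words, their inverses, and the full twist *)

Definition crossing (n : nat) (L : layer) : bool :=
  match L with Cross p | CrossV p => (p.+1 < n)%N | _ => false end.

(** On words of crossings this is the inverse braid word. *)
Definition mirror (w : seq layer) : seq layer := rev (map flip_layer w).

Lemma crossing_admissible s L : crossing (size s) L -> admissible s L.
Proof. by case: L. Qed.

Lemma size_above_crossing s L : crossing (size s) L ->
  size (above s L) = size s.
Proof.
case: L => //= p ps; rewrite !size_cat /= size_drop size_takel 1?ltnW 1?ltnW //;
  by rewrite !addnS -!addSn subnKC.
Qed.

Lemma tangle_crossings s w :
  all (crossing (size s)) w -> tangle s w (foldl above s w).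
Proof.
elim: w s => //= L w IH s /andP[sL sw].
by rewrite crossing_admissible // IH // size_above_crossing.
Qed.

Lemma crossing_flip n L : crossing n (flip_layer L) = crossing n L.
Proof. by case: L. Qed.

Lemma all_crossing_mirror n w :
  all (crossing n) (mirror w) = all (crossing n) w.
Proof.
by rewrite all_rev all_map; apply: eq_all => L /=; exact: crossing_flip.
Qed.

(** A view exposing the two entries on which a crossing at [p] acts. *)
Variant split_at (T : Type) (p : nat) (s : seq T) : Prop :=
  SplitAt s1 x y s2 of size s1 = p & s = s1 ++ x :: y :: s2.

Lemma split_atP T p (s : seq T) : (p.+1 < size s)%N -> split_at p s.
Proof.
case: s => // x0 s ps.
exists (take p (x0 :: s)) (nth x0 (x0 :: s) p) (nth x0 (x0 :: s) p.+1)
  (drop p.+2 (x0 :: s)).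
  by rewrite size_takel 1?ltnW 1?ltnW.
by rewrite -(drop_nth x0 ps) -(drop_nth x0 (ltnW ps)) cat_take_drop.
Qed.

Lemma above_split (s1 s2 : seq bool) a b L p : size s1 = p ->
  L = Cross p \/ L = CrossV p ->
  above (s1 ++ a :: b :: s2) L = s1 ++ b :: a :: s2.
Proof.
move=> <- [] -> /=; rewrite take_size_cat // !nth_cat !ltnNge leqnn leqnSn /=;
  by rewrite subSnn subnn -[X in drop X _](addn2) addnC -drop_drop
    drop_size_cat //= drop0.
Qed.

Lemma above_flipK s L :
  crossing (size s) L -> above (above s L) (flip_layer L) = s.
Proof.
by case: L => // p /= /split_atP[s1 x y s2 sp ->];
   (* Both steps can be folded as [Cross], since [above] treats [Cross] and [CrossV] alike. *)
   rewrite -!/(above _ (Cross _)) (above_split _ _ _ sp) ?(above_split _ _ _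
     sp); auto.
Qed.

Lemma state_mirror s w :
  all (crossing (size s)) w -> foldl above (foldl above s w) (mirror w) = s.
Proof.
elim: w s => //= L w IH s /andP[sL sw].
rewrite /mirror /= rev_cons -cats1 foldl_cat [foldl _ _ (rev _)]IH /=
  ?above_flipK //.
by rewrite size_above_crossing.
Qed.

Lemma all_crossing_full_twist n : all (crossing n) (full_twist n).
Proof.
have sweep : all (crossing n) [seq Cross p | p <- iota 0 n.-1].
  by rewrite all_map; apply/allP => p; rewrite mem_iota /=; case: n.
by rewrite /full_twist; elim: (X in nseq X) => //= k IH; rewrite all_cat sweep.
Qed.

(** Each crossing moves [a] one place to the right; with [s1] empty, one sweep rotates the level by
    one. *)
Lemma state_sweep (s1 s2 : seq bool) a :
  foldl above (s1 ++ a :: s2) [seq Cross p | p <- iota (size s1) (size s2)] =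
  s1 ++ rcons s2 a.
Proof.
elim: s2 s1 => // b s2 IH s1.
rewrite -[LHS]/(foldl above (above _ (Cross (size s1))) (map Cross (iota _.+1
  _))).
rewrite (above_split _ _ _ (erefl _)); last by left.
by rewrite -cat_rcons -(size_rcons s1 b) IH cat_rcons.
Qed.

Lemma state_full_twist s : foldl above s (full_twist (size s)) = s.
Proof.
(* The number of sweeps, but not their length, is generalised to [k <= size s]; after [k] sweeps the
   level is [rot k s]. *)
rewrite /full_twist -[RHS]rot_size; elim: {1 3 5}(size s) (leqnn (size s)) =>
  [|k IH] ks.
  by rewrite rot0.
rewrite -addn1 nseqD flatten_cat foldl_cat IH 1?ltnW //= cats0 addn1 rotS //.
rewrite -[X in iota 0 X.-1](size_rot k s).
by case: (rot k s) => // a t; rewrite (state_sweep [::]) rot1_cons.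
Qed.

Lemma tangle_full_twist_pow s n : tangle s (full_twist_pow (size s) n) s.
Proof.
have ft := all_crossing_full_twist (size s).
have sft := state_full_twist s.
case: n => k; apply: tangle_nseq.
  by rewrite -[X in tangle _ _ X]sft; apply: tangle_crossings.
rewrite -{3}(state_mirror ft) sft.
by apply: tangle_crossings; rewrite all_crossing_mirror.
Qed.

(** * The tangle functor in matrix form *)

Lemma tuple_sum_delta (R : nzRingType) (A : finType) n (i : seq A)
    (F : seq A -> R) :
  size i = n -> \sum_(k : n.-tuple A) (i == k)%:R * F k = F i.
Proof.
move=> /eqP si; rewrite (bigD1 (Tuple si)) //= eqxx mul1r big1 ?addr0 // => k.
by rewrite -val_eqE eq_sym /= => /negPf->; rewrite mul0r.
Qed.

Section Functor.
Variables (D : cartan_datum) (m : nat) (M : uq_data D m).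
Variable Theta : seq 'I_(rank D) -> seq 'I_(rank D) -> Qv.
Local Notation T := (tangle_coef M Theta).

(** Functoriality under stacking. The size condition places [i] among the tuples summed over when
    [w1] is empty. *)
Lemma tangle_coef_cat s w1 w2 i j : size i = size s ->
  T s (w1 ++ w2) i j = \sum_(k : (size (foldl above s w1)).-tuple 'I_m)
    T s w1 i k * T (foldl above s w1) w2 k j.
Proof.
elim: w1 s i => [|L w IH] s i si /=;
  first by rewrite (tuple_sum_delta (fun k => T s w2 k j)).
under eq_bigr => k _ do rewrite IH ?size_tuple // mulr_sumr.
rewrite exchange_big; apply: eq_bigr => l _ /=; rewrite mulr_suml.
by apply: eq_bigr => k _; rewrite mulrA.
Qed.

Definition crossing_coef s L : 'I_m -> 'I_m -> 'I_m -> 'I_m -> Qv :=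
  match L with
  | Cross p => cross_coef M Theta (nth true s p) (nth true s p.+1)
  | CrossV p => crossV_coef M Theta (nth true s p) (nth true s p.+1)
  | _ => fun _ _ _ _ => 0
  end.

Lemma layer_coef_crossing s L p i1 x y i2 j1 z t j2 :
  L = Cross p \/ L = CrossV p -> size i1 = p -> size j1 = p ->
  layer_coef M Theta s L (i1 ++ x :: y :: i2) (j1 ++ z :: t :: j2) =
  ((i1 == j1) && (i2 == j2))%:R * crossing_coef s L x y z t.
Proof.
by move=> Lp si sj; case: Lp => -> /=;
   rewrite !drop_size_cat // !take_size_cat.
Qed.

Hypothesis crossing_unit : forall a b,
  Rop (colour M a) (colour M b) Theta \in unitmx.

Lemma crossing_coefK (s1 s2 : seq bool) a b L p x y z t :
  L = Cross p \/ L = CrossV p -> size s1 = p ->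
  \sum_u \sum_v crossing_coef (s1 ++ a :: b :: s2) L x y u v *
    crossing_coef (s1 ++ b :: a :: s2) (flip_layer L) u v z t =
  ((x == z) && (y == t))%:R.
Proof.
move=> Lp sp; have nths c d : (nth true (s1 ++ c :: d :: s2) (size s1) = c) *
    (nth true (s1 ++ c :: d :: s2) (size s1).+1 = d).
  by rewrite !nth_cat !ltnNge leqnn leqnSn /= subSnn subnn.
have pairE (u v u' v' : 'I_m) :
    (mxtens_index (u, v) == mxtens_index (u', v')) = (u == u') && (v == v').
  by rewrite (can_eq (@mxtens_indexK m m)) xpair_eqE.
have reidx (A B : 'M[Qv]_(m * m)) i j :
    (A *m B) i j = \sum_u \sum_v A i (mxtens_index (u, v)) * B (mxtens_index
      (u, v)) j.
  rewrite mxE pair_big /= (reindex (@mxtens_index m m)) /=.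
    by apply: eq_bigr => -[u v] _.
  by exists (@mxtens_unindex m m) => k _; rewrite ?mxtens_indexK
    ?mxtens_unindexK.
(* Rows of [Rop] index the output, so with [R] the relevant [Rop] the sum is [invmx R *m R] for
   [Cross] and [R *m invmx R] for [CrossV]. In the second case the intermediate pair occurs as
   [(v, u)], hence the exchange of sums. *)
case: Lp => ->; rewrite /= -sp !nths /cross_coef /crossV_coef.
  under eq_bigr => u _ do under eq_bigr => v _ do rewrite mulrC.
  by rewrite -reidx mulVmx // mxE pairE eq_sym andbC eq_sym;
    congr (_ && _)%:R; rewrite eq_sym.
rewrite exchange_big /=.
under eq_bigr => u _ do under eq_bigr => v _ do rewrite mulrC.
by rewrite -reidx mulmxV // mxE pairE eq_sym; congr (_ && _)%:R; rewrite eq_sym.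
Qed.

(** A crossing acts on two neighbouring tensor factors and as the identity on the others, which
    reduces the claim to [crossing_coefK]. *)
Lemma layer_coefK s L i j : crossing (size s) L ->
  size i = size s -> size j = size s ->
  \sum_(k : (size s).-tuple 'I_m) layer_coef M Theta s L i k *
     layer_coef M Theta (above s L) (flip_layer L) k j = (i == j)%:R.
Proof.
move=> sL si sj.
have [p Lp ps] : exists2 p, L = Cross p \/ L = CrossV p & (p.+1 < size s)%N.
  by case: L sL => // p ps; exists p; auto.
have flp : flip_layer L = Cross p \/ flip_layer L = CrossV p.
  by case: Lp => ->; auto.
have [s1 a b s2 s1p sE] := split_atP ps.
have := ps; rewrite -{1}si => /split_atP[i1 x y i2 i1p iE].
have := ps; rewrite -{1}sj => /split_atP[j1 z t j2 j1p jE].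
(* Writing the first layer as a sum of deltas over the middle pair makes the sum over [k]
   collapse. *)
have step (k : (size s).-tuple 'I_m) : layer_coef M Theta s L i k =
    \sum_u \sum_v (i1 ++ u :: v :: i2 == k)%:R * crossing_coef s L x y u v.
  have := ps; rewrite -{1}(size_tuple k) => /split_atP[k1 u v k2 k1p kE].
  rewrite kE iE (layer_coef_crossing _ _ _ _ _ _ _ Lp) //.
  have eqE u' v' : (i1 ++ u' :: v' :: i2 == k1 ++ u :: v :: k2) =
      [&& i1 == k1, u' == u, v' == v & i2 == k2].
    by rewrite eqseq_cat ?i1p ?k1p // !eqseq_cons.
  rewrite (bigD1 u) //= (bigD1 v) //= eqE !eqxx /= !big1 ?addr0 // => [u'
    /negPf ne | v' /negPf ne].
    by rewrite big1 // => v' _; rewrite eqE ne andbF mul0r.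
  by rewrite eqE ne !andbF mul0r.
under eq_bigr => k _ do rewrite step mulr_suml.
rewrite exchange_big /=.
under eq_bigr => u _ do (under eq_bigr => k _ do rewrite mulr_suml;
  rewrite exchange_big /=).
transitivity (\sum_u \sum_v crossing_coef s L x y u v *
    layer_coef M Theta (above s L) (flip_layer L) (i1 ++ u :: v :: i2) j).
  apply: eq_bigr => u _; apply: eq_bigr => v _.
  under eq_bigr => k _ do rewrite -mulrA.
  rewrite (tuple_sum_delta (fun k => crossing_coef s L x y u v *
    layer_coef M Theta (above s L) (flip_layer L) k j)) //.
  by rewrite -si iE !size_cat.
rewrite sE (above_split _ _ _ s1p Lp) jE.
under eq_bigr => u _ do under eq_bigr => v _ do
  rewrite (layer_coef_crossing _ _ _ _ _ _ _ flp) // mulrCA.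
under eq_bigr => u _ do rewrite -mulr_sumr.
rewrite -mulr_sumr (crossing_coefK _ _ _ _ _ _ _ Lp s1p) iE -natrM mulnb
  eqseq_cat ?i1p ?j1p // !eqseq_cons.
by rewrite -!andbA; do 2!case: (_ == _) => //=; rewrite ?andbF ?andbT.
Qed.

(** The inner word cancels by induction, leaving the first layer next to its inverse, with which the
    mirror ends. *)
Lemma tangle_coef_mirror s w i j : all (crossing (size s)) w ->
  size i = size s -> size j = size s -> T s (w ++ mirror w) i j = (i == j)%:R.
Proof.
elim: w s i j => //= L w IH s i j /andP[sL sw] si sj.
have s1 := size_above_crossing sL.
rewrite -(layer_coefK sL si sj) s1; apply: eq_bigr => k _; congr (_ * _).
rewrite /mirror /= rev_cons -cats1 catA tangle_coef_cat ?size_tuple ?s1 //.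
rewrite foldl_cat state_mirror s1 //.
under eq_bigr => l _ do rewrite IH ?s1 ?size_tuple //.
rewrite (tuple_sum_delta (fun l => T (above s L) [:: flip_layer L] l j))
  ?size_tuple ?s1 //= above_flipK //.
under eq_bigr => l _ do rewrite mulrC eq_sym.
exact: (tuple_sum_delta (fun l => layer_coef M Theta (above s L) (flip_layer L)
  k l)).
Qed.

Section Operator.
Variables (n : nat) (s : seq bool).
Hypothesis size_s : size s = n.

(** Rows index the bottom of the tangle, so stacking upwards is multiplication from left to
    right. *)
Definition tangle_mx w : 'M[Qv]_#|{: n.-tuple 'I_m}| :=
  \matrix_(a, b)
    T s w (enum_val a : n.-tuple 'I_m) (enum_val b : n.-tuple 'I_m).

Lemma tangle_mx_nil : tangle_mx [::] = 1%:M.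
Proof.
by apply/matrixP => a b; rewrite !mxE /= val_eqE (inj_eq enum_val_inj).
Qed.

Lemma tangle_mx_cat w1 w2 : foldl above s w1 = s ->
  tangle_mx (w1 ++ w2) = tangle_mx w1 *m tangle_mx w2.
Proof.
move=> sw; apply/matrixP => a b; rewrite !mxE tangle_coef_cat ?size_tuple
  ?size_s //.
rewrite sw size_s (reindex _ (onW_bij _ (@enum_val_bij (n.-tuple 'I_m)))) /=.
by apply: eq_bigr => k _; rewrite !mxE.
Qed.

Lemma tangle_mx_nseq w k : foldl above s w = s ->
  tangle_mx (flatten (nseq k w)) = tangle_mx w ^+ k.
Proof.
move=> sw; elim: k => [|k IH] /=; first exact: tangle_mx_nil.
by rewrite tangle_mx_cat // IH exprS.
Qed.

Lemma tangle_mx_mirror w : all (crossing n) w -> foldl above s w = s ->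
  tangle_mx w *m tangle_mx (mirror w) = 1%:M.
Proof.
move=> cw sw; rewrite -tangle_mx_cat //; apply/matrixP => a b.
rewrite !mxE tangle_coef_mirror ?size_tuple ?size_s //.
by rewrite val_eqE (inj_eq enum_val_inj).
Qed.

End Operator.

End Functor.

(** * Invertibility of the braiding through the height grading *)

Lemma unitriangular_unitmx (F : fieldType) (R : realDomainType) n (A : 'M[F]_n)
    (ht : 'I_n -> R) :
  (forall a b, A a b != (a == b)%:R -> ht b < ht a) -> A \in unitmx.
Proof.
move=> triA; rewrite unitmxE unitfE; apply/negP => /det0P[v v0 vA].
have /rV0Pn[b0 vb0] := v0.
(* At an index [b] of maximal height in the support of the kernel vector [v], only the diagonal
   entry, equal to 1, contributes to [v *m A], forcing [v 0 b = 0]. *)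
case: (@arg_maxP _ _ _ b0 (fun b => v 0 b != 0) ht vb0) => b vb bmax.
have/matrixP/(_ 0 b) := vA; rewrite !mxE (bigD1 b) //= big1 => [|a ab].
  case: (eqVneq (A b b) 1) => [->|Abb]; first by rewrite addr0 mulr1 => /eqP;
    apply/negP.
  by have := triA b b; rewrite eqxx ltxx => /(_ Abb).
case: (eqVneq (v 0 a) 0) => [->|va]; first by rewrite mul0r.
case: (eqVneq (A a b) 0) => [->|Aab]; first by rewrite mulr0.
have := triA a b; rewrite (negPf ab) Aab => /(_ isT).
by rewrite ltNge => /negP[]; exact: bmax.
Qed.

Lemma tofracX_exprz_inj (F : fieldType) :
  injective (fun a : int => (tofrac 'X : {fraction {poly F}}) ^ a).
Proof.
have X0 : (tofrac 'X : {fraction {poly F}}) != 0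
  by rewrite tofrac_eq0 polyX_eq0.
have X1 n : (tofrac 'X : {fraction {poly F}}) ^+ n = 1 -> n = 0%N.
  rewrite -tofracXn => /eqP; rewrite -tofrac1 tofrac_eq => /eqP Xn1.
  by have := size_polyXn F n; rewrite Xn1 size_poly1 => -[].
move=> a b /= ab; apply/eqP; rewrite -subr_eq0; apply/eqP.
have : (tofrac 'X : {fraction {poly F}}) ^ (a - b) = 1.
  by rewrite expfzDr // ab -expfzDr // subrr.
case: (a - b) => n /= h; first by rewrite (X1 n h).
by have /X1 : (tofrac 'X : {fraction {poly F}}) ^+ n.+1 = 1 by apply: invr_inj;
  rewrite invr1.
Qed.

Lemma qpow_neq0 D x : qpow D x != 0.
Proof. by rewrite /qpow expfz_neq0 // tofrac_eq0 polyX_eq0. Qed.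

Section Cartan.
Variable D : cartan_datum.
Local Notation A := (map_mx intr (cartan D) : 'M[rat]_(rank D)).

(** A kernel vector would be isotropic for the symmetrised form, which is positive definite by
    [cartan_finite]. *)
Lemma cartan_det_neq0 : \det (cartan D) != 0.
Proof.
apply/eqP => det0; have : \det A^T == 0 by rewrite det_tr det_map_mx det0.
move=> /det0P[v v0 vA].
have /rV0Pn[i vi] := v0.
have := @cartan_finite D (fun i => v 0 i) (ex_intro _ i vi).
rewrite big1 ?ltxx // => k _.
have/matrixP/(_ 0 k) := vA; rewrite !mxE => vAk.
transitivity ((symm D k)%:R * v 0 k * \sum_j v 0 j * A^T j k);
  last by rewrite vAk mulr0.
rewrite mulr_sumr; apply: eq_bigr => j _; rewrite !mxE -!mulrA; congr (_ * _).
by rewrite mulrCA [v 0 j * _]mulrC.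
Qed.

Lemma root_order_gt0 : (0 < root_order D)%N.
Proof. by rewrite muln_gt0 absz_gt0 cartan_det_neq0. Qed.

(** The factor 2 in [root_order] makes the exponent an integer, so the floor in [qpow] is exact. *)
Lemma q_E i : q_ i = tofrac 'X ^ (symm D i * `|\det (cartan D)|)%:Z.
Proof.
rewrite /q_ /qpow /root_order natrM mulrA divfK ?pnatr_eq0 // -natrM.
by rewrite -[_%:R]/(_%:Z%:~R) intrKfloor.
Qed.

Lemma q_exprz_inj (i : 'I_(rank D)) : injective (fun a : int => q_ i ^ a).
Proof.
move=> a b /=; rewrite q_E !exprz_exp => /tofracX_exprz_inj/mulfI; apply.
by rewrite eqz_nat muln_eq0 negb_or absz_eq0 cartan_det_neq0 andbT -lt0n
  symm_gt0.
Qed.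

Lemma q_neq0 (i : 'I_(rank D)) : q_ i != 0.
Proof. by rewrite q_E expfz_neq0 // tofrac_eq0 polyX_eq0. Qed.

(* Sum of the coordinates in the basis of simple roots. *)
Definition weight_height (la : 'rV[int]_(rank D)) : rat :=
  \sum_i (map_mx intr la *m invmx A^T) 0 i.

(** A column of the Cartan matrix, since [cartan j i] is the value of alpha_i on the coroot of index
    [j]. *)
Definition simple_root (i : 'I_(rank D)) : 'rV[int]_(rank D) :=
  row i (cartan D)^T.

Lemma weight_heightD : {morph weight_height : la mu / la + mu}.
Proof.
move=> la mu; rewrite /weight_height map_mxD mulmxDl -big_split.
by apply: eq_bigr => i _; rewrite mxE.
Qed.

Lemma weight_height_simple i : weight_height (simple_root i) = 1.
Proof.
have Au : A^T \in unitmx.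
  by rewrite unitmx_tr unitmxE det_map_mx unitfE intr_eq0 cartan_det_neq0.
rewrite /weight_height /simple_root map_row -map_trmx rowE -mulmxA mulmxV //
  mulmx1.
rewrite (bigD1 i) //= big1 ?addr0 => [|j ji]; first by rewrite mxE !eqxx.
by rewrite mxE eqxx (negPf ji).
Qed.

(** This consequence of the module axioms gives unitriangularity and passes easily to the dual. *)
Definition raises_height m (M : uq_data D m) := forall i b b',
  uE M i b b' != 0 -> weight_height (wt M b) = weight_height (wt M b') + 1.

(** At a nonzero entry of [uE M j], the relation [uq_KE] equates two powers of each [q_ i]; as
    [q_ i] has infinite order, the weights differ by the simple root of index [j]. *)
Lemma uq_module_raises_height m (M : uq_data D m) :
  uq_module M -> raises_height M.
Proof.
move=> Mod j b b' Ebb; rewrite -(weight_height_simple j) -weight_heightD;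
  congr weight_height.
apply/rowP => i; rewrite !mxE.
have/matrixP/(_ b b') := uq_KE Mod i j; rewrite mul_diag_mx mul_mx_diag !mxE.
rewrite mulrA [q_ i ^ _ * _]mulrC -mulrA mulrC => /(mulfI Ebb).
by rewrite -expfzDr ?q_neq0 // => /q_exprz_inj ->; rewrite addrC.
Qed.

(** Transposition and the negation of weights each reverse the direction, and the two reversals
    cancel. *)
Lemma uq_dual_raises_height m (M : uq_data D m) :
  raises_height M -> raises_height (uq_dual M).
Proof.
move=> hM i b b' /=; rewrite 2!mxE oppr_eq0 /uKV mul_diag_mx !mxE mulf_eq0
  negb_or.
case/andP=> _ /hM h; have htN la : weight_height (- la) = - weight_height la.
  apply/eqP; rewrite -addr_eq0 -weight_heightD addNr /weight_height map_mx0
    mul0mx.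
  by rewrite big1 // => k _; rewrite mxE.
by rewrite !htN h opprD addrNK.
Qed.

Lemma uq_word_raises_height m (M : uq_data D m) s b b' : raises_height M ->
  uq_word (uE M) s b b' != 0 ->
  weight_height (wt M b) = weight_height (wt M b') + (size s)%:R.
Proof.
move=> hM; elim: s b => [|i s IH] b /=.
  by rewrite mxE addr0; case: (b =P b') => [->|_]; rewrite ?eqxx.
rewrite mxE => nz; have [c] : exists c, uE M i b c * uq_word (uE M) s c b' != 0.
  apply/existsP; apply: contraNT nz => /existsPn z; rewrite big1 // => c _.
  by apply/eqP; rewrite -[_ == _]negbK z.
rewrite mulf_eq0 negb_or => /andP[/hM-> /IH->].
by rewrite -addrA -natr1.
Qed.

(** Terms with words of length [k > 0] raise the height in [N] by [k], and the empty words
    contribute the identity. *)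
Lemma theta_mx_unit m n (M : uq_data D m) (N : uq_data D n) Theta :
  raises_height N -> Theta [::] [::] = 1 -> theta_mx M N Theta \in unitmx.
Proof.
move=> hN Theta1.
apply: (@unitriangular_unitmx _ rat _ _
  (fun a => weight_height (wt N (mxtens_unindex a).2))) => a b.
case: (mxtens_indexP a) => i j; case: (mxtens_indexP b) => i' j'.
rewrite !mxtens_indexK /= ltNge; apply: contra => le_ht.
(* The index [j] witnesses [0 < n], so the sum over [k < n] does contain the term [k = 0]. *)
have n0 : (0 < n)%N := leq_ltn_trans (leq0n j) (ltn_ord j).
rewrite /theta_mx summxE (bigD1 (Ordinal n0)) //= [X in _ + X]big1 ?addr0 =>
  [|k k0].
  have tuple0_sum (G : 0.-tuple 'I_(rank D) -> 'M[Qv]_(m * n)) :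
      \sum_u G u = G [tuple].
    by apply: big_pred1 => u; apply/esym/eqP; exact: tuple0.
  rewrite !tuple0_sum.
  rewrite /= Theta1 scale1r tensmxE !mxE -natrM mulnb.
  by rewrite (can_eq (@mxtens_indexK m n)) xpair_eqE.
rewrite summxE big1 // => u _; rewrite summxE big1 // => v _.
rewrite mxE tensmxE; case: (eqVneq (uq_word (uE N) v j j') 0) => [->|];
  first by rewrite !mulr0.
move/(uq_word_raises_height hN) => E; move: le_ht;
  rewrite E size_tuple gerDl lern0.
by move/eqP=> kE; case/eqP: k0; apply/val_inj.
Qed.

Lemma Rop_unit m n (M : uq_data D m) (N : uq_data D n) Theta :
  raises_height N -> Theta [::] [::] = 1 -> Rop M N Theta \in unitmx.
Proof.
move=> hN Theta1; rewrite unitmx_mul theta_mx_unit //= unitmxE det_diag unitfE.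
apply/prodf_neq0 => x _; rewrite mxE; case: (mxtens_unindex x) => i j.
exact: qpow_neq0.
Qed.

End Cartan.

(** * From a relation among matrix powers to a recurrence over all integers *)

Section TwoSidedPowers.
Variables (R : pzRingType) (x y : R) (P : int -> R).
Hypothesis yx : y * x = 1.
Hypotheses (Ppos : forall k : nat, P k%:Z = x ^+ k).
Hypotheses (Pneg : forall k : nat, P (Negz k) = y ^+ k.+1).

Lemma two_sided_powersD n (k : nat) : P (n + k%:Z) = P n * x ^+ k.
Proof.
have step i : P (i + 1) = P i * x.
  (* [Negz 0] is -1, where the step leads from the negative powers to [P 0 = 1]. *)
  case: i => [i|[|i]].
  - by rewrite (_ : Posz i + 1 = i.+1%:Z) ?Ppos ?exprSr // -addn1 PoszD.
  - by rewrite Pneg expr1 yx (Ppos 0).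
  - have -> : Negz i.+1 + 1 = Negz i by rewrite !NegzE -addn1 PoszD opprD
      addrNK.
    by rewrite !Pneg [y ^+ i.+2]exprSr -mulrA yx mulr1.
elim: k => [|k IH]; first by rewrite addr0 mulr1.
by rewrite -addn1 PoszD addrA step IH -mulrA -exprSr addn1.
Qed.

End TwoSidedPowers.

(** Since [P (n + k) = P n *m B ^+ k] for every integer [n], multiplying one relation among the
    powers of [B] by [P n] gives the recurrence at [n]. *)
Lemma matrix_coef_recurrent D p (B B' : 'M[Qv]_p) (P : int -> 'M[Qv]_p)
    (x : 'rV[Qv]_p) (y : 'cV[Qv]_p) :
  B *m B' = 1%:M -> (forall k : nat, P k%:Z = B ^+ k) ->
  (forall k : nat, P (Negz k) = B' ^+ k.+1) ->
  recurrent D (fun n => (x *m P n *m y) 0 0).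
Proof.
move=> BB' Ppos Pneg; have B'B := mulmx1C BB'.
have [d [u [u0 uB]]] := matrix_annihilator (root_order_gt0 D) B.
exists d, (fun k => tofrac (u k \Po 'X^(root_order D))); split.
- by move=> k; exists (u k), 1; rewrite oner_neq0 comp_polyC tofrac1 divr1.
(* Substituting [X^N] is injective: the coefficient of index [i] moves to index [i * N]. *)
- rewrite tofrac_eq0; apply: contra u0 => /eqP uX0; apply/eqP/polyP => i.
  have := congr1 (fun q : {poly rat} => q`_(i * root_order D)) uX0.
  by rewrite coef_comp_poly_Xn ?root_order_gt0 // dvdn_mull // mulnK
    ?root_order_gt0 // !coef0.
move=> n; transitivity ((x *m (P n *m
    \sum_k tofrac (u k \Po 'X^(root_order D)) *: B ^+ (k : nat)) *m y) 0 0).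
  rewrite !mulmx_sumr mulmx_suml summxE; apply: eq_bigr => k _.
  rewrite (two_sided_powersD B'B Ppos Pneg) -!scalemxAr -scalemxAl [RHS]mxE.
  by [].
by rewrite uB !mulmx0 mul0mx mxE.
Qed.

Lemma recurrent_ext D (R R' : int -> Qv) :
  R =1 R' -> recurrent D R -> recurrent D R'.
Proof.
move=> RR' [d [c [cq c0 cR]]]; exists d, c; split=> // n.
by rewrite -[RHS](cR n); apply: eq_bigr => k _; rewrite RR'.
Qed.

Theorem theorem1p2
  (C : numClosedFieldType) (g : vectType C) (br : g -> g -> g)
  (g_simple : simple_lie br)
  (D : cartan_datum) (e f h : 'I_(rank D) -> g)
  (g_gen : chevalley_generators br e f h)
  (V : vectType C) (rho : g -> 'End(V)) (rho_rep : lie_rep br rho)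
  (c : rat) (c_casimir : casimir_value br h rho c)
  (m : nat) (Vq : uq_data D m) (Vq_mod : uq_module Vq)
  (Vq_def : quantizes h rho Vq)
  (Theta : seq 'I_(rank D) -> seq 'I_(rank D) -> Qv)
  (Theta_R : quasi_Rmatrix Theta)
  (L : axis_link) :
  recurrent D (fun n : int =>
    qpow D (Qexp c L n) * quantum_invariant Vq Theta c (surgery_knot L n)).
Proof.
have ht a : raises_height (colour Vq a).
  have hV := uq_module_raises_height Vq_mod.
  by case: a => //; apply: uq_dual_raises_height.
have Ru a b : Rop (colour Vq a) (colour Vq b) Theta \in unitmx.
  by apply: Rop_unit; [exact: ht | exact: theta_nil Theta_R].
(* [s'] lists the orientations of the return strands. The operators below act on all [p] strands,
   the twist involving only the first [r]. *)
set s := ends L; pose s' := map negb (rev s); pose r := size s.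
pose p := size (s ++ s').
pose cups := [seq Cup i (nth true s i) | i <- iota 0 r].
pose caps := [seq Cap i | i <- rev (iota 0 r)].
pose N := #|{: p.-tuple 'I_m}|.
pose tup (a : 'I_N) : seq 'I_m := (enum_val a : p.-tuple 'I_m).
pose x : 'rV[Qv]_N := \row_a tangle_coef Vq Theta [::]
  (cups ++ strand L) [::] (tup a).
pose y : 'cV[Qv]_N := \col_a tangle_coef Vq Theta (s ++ s') caps (tup a) [::].
pose P n := tangle_mx Vq Theta p (s ++ s') (full_twist_pow r n).
pose B := tangle_mx Vq Theta p (s ++ s') (full_twist r).
pose B' := tangle_mx Vq Theta p (s ++ s') (mirror (full_twist r)).
have twist n : foldl above (s ++ s') (full_twist_pow r n) = s ++ s'.
  exact: tangle_state (tangle_catr _ (tangle_full_twist_pow s n)).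
have ft : foldl above (s ++ s') (full_twist r) = s ++ s'.
  by have := twist 1; rewrite /= cats0.
have ft' : foldl above (s ++ s') (mirror (full_twist r)) = s ++ s'.
  by have := twist (Negz 0); rewrite /= cats0.
have ftc : all (crossing p) (full_twist r).
  apply: sub_all (all_crossing_full_twist r) => -[] //= k kr;
    by rewrite /p size_cat (leq_trans kr) ?leq_addr.
apply: (@recurrent_ext _ (fun n => (x *m P n *m y) 0 0)); last first.
  apply: (@matrix_coef_recurrent D N B B' P).
  - exact: tangle_mx_mirror.
  - by move=> k; apply: tangle_mx_nseq.
  - by move=> k; apply: tangle_mx_nseq.
(* The closed diagram and the open tangle have equal writhe, so the two powers of q cancel. *)
move=> n; rewrite /quantum_invariant /Qexp /framing_exponent writhe_closure;
  last first.
  by apply: tangle_cat (strand_tangle L) _; exact: tangle_full_twist_pow.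
rewrite mulrA divff ?qpow_neq0 // mul1r.
have -> : surgery_knot L n = (cups ++ strand L) ++ full_twist_pow r n ++ caps.
  by rewrite /surgery_knot /tangle_closure /twisted_tangle -!catA.
have start : foldl above [::] (cups ++ strand L) = s ++ s'.
  by rewrite foldl_cat state_cups (tangle_state (tangle_catr _ (strand_tangle
    L))).
(* Cutting the closed diagram below and then above the twist turns its evaluation into
   [x *m P n *m y]. *)
rewrite tangle_coef_cat // start -mulmxA mxE.
rewrite [RHS](reindex _ (onW_bij _ (@enum_val_bij (p.-tuple 'I_m)))) /=.
apply: eq_bigr => a _; rewrite !mxE; congr (_ * _).
rewrite tangle_coef_cat ?size_tuple // twist.
rewrite [RHS](reindex _ (onW_bij _ (@enum_val_bij (p.-tuple 'I_m)))) /=.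
by apply: eq_bigr => b _; rewrite !mxE.
Qed.
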